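(* Let $F/K$ be a finite Galois totally ramified extension of complete discrete valuation fields with residue characteristic $p>0$, and let $F_1\subsetneq\dots\subsetneq F_{h+1}=F$, the jumps $b_1<\dots<b_h$ (all prime to $p$), the integers $n_i$, the valuations $v_i$ and the elements $f_i\in F_{i+1}$ with $v_{i+1}(f_i)=-b_i$ be as in the context. For every $i$ with $2\le i\le h$, let $m_i(X)\in F_i[X]$ be the minimal polynomial of $f_i$ over $F_i$ and put $D_i:=-m_i(0)\in F_i$. Then there exist $\kappa_i\in F_1\setminus\{0\}$ and integers $w_1,\dots,w_{i-1}$, not all zero, with $0\le w_j<p^{n_j}$ for all $j=1,\dots,i-1$, such that $$D_i=\kappa_i f_1^{w_1}\cdots f_{i-1}^{w_{i-1}}+\{\text{terms of strictly greater valuation}\}.$$ Moreover, the minimal polynomial evaluated at $f_i$, i.e. the equality $m_i(f_i)+D_i=D_i$, has the form $$f_i^{p^{n_i}}+\ast=\kappa_i f_1^{w_1}\cdots f_{i-1}^{w_{i-1}}+\ast,$$ where on each side $\ast$ stands for terms of strictly greater $v_{i+1}$-valuation than the displayed term of that side, the left side being $m_i(f_i)+D_i$ and the right side being $D_i$.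
   Context: $K$ is a complete discrete valuation field with residue field of characteristic $p>0$ (the characteristic of $K$ is $0$ or $p$) and $F/K$ is a finite Galois extension that is totally ramified ($[F:K]$ equals the ramification index). Let $v_F$ be the normalized valuation and $\pi_F$ a uniformizer of $F$. The lower ramification groups are $G_j=\{\sigma\in\mathrm{Gal}(F/K): v_F(\sigma(\pi_F)-\pi_F)\ge j+1\}$, and $j$ is a jump if $G_j\supsetneq G_{j+1}$. Assume $G_1\ne\{1\}$ and let $1\le b_1<\dots<b_h$ be the jumps of the filtration of $G_1$, so $G_1=G_{b_1}\supsetneq G_{b_2}\supsetneq\dots\supsetneq G_{b_h}\supsetneq G_{b_{h+1}}:=\{1\}$ with $G_{b_i}/G_{b_{i+1}}\simeq(\mathbb{Z}/p\mathbb{Z})^{n_i}$, $n_i\ge1$. All $b_i$ are assumed prime to $p$. Put $F_i=F^{G_{b_i}}$ for $1\le i\le h+1$ (so $F_1=F^{G_1}$, $F_{h+1}=F$, $[F_{i+1}:F_i]=p^{n_i}$) and let $v_i$ be the normalized valuation of $F_i$. For each $i=1,\dots,h$ fix $f_i\in F_{i+1}$ with $v_{i+1}(f_i)=-b_i$. *)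

(* Defs.v *)
From mathcomp Require Import all_boot all_order all_algebra all_fingroup.
From mathcomp Require Import all_solvable all_field.
From mathcomp Require Import constructive_ereal.

Set Implicit Arguments.
Unset Strict Implicit.
Unset Printing Implicit Defensive.

Import Order.TTheory GRing.Theory Num.Theory.
Local Open Scope ring_scope.

(* Valuations take values in \bar int, so that v 0 = +oo and inequalities     *)
(* such as v (s pi - pi) >= j + 1 also make sense when s pi = pi.  The value  *)
(* -oo is never taken.                                                        *)
Definition normalized_valuation (L : fieldType) (v : L -> \bar int) : Prop :=
  [/\ v 0 = +oo%E,
      forall x, x != 0 -> v x \is a fin_num,
      forall x y, v (x * y) = (v x + v y)%E,
      forall x y, (Order.min (v x) (v y) <= v (x + y)%R)%E
    & exists x, v x = 1%:E].

Definition complete_valuation (L : fieldType) (v : L -> \bar int) : Prop :=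
  forall u : nat -> L,
    (forall n : nat, exists N : nat, forall i j : nat,
       (N <= i)%N -> (N <= j)%N -> ((n%:Z)%:E <= v (u i - u j)%R)%E) ->
  exists l : L,
    forall n : nat, exists N : nat, forall i : nat,
      (N <= i)%N -> ((n%:Z)%:E <= v (u i - l)%R)%E.

(* With O = {x | v x >= 0} and m = {x | v x > 0}, the second condition says   *)
(* that p%:R vanishes in the residue field O / m.                             *)
Definition residue_char (L : fieldType) (v : L -> \bar int) (p : nat) : Prop :=
  prime p /\ (0 < v p%:R)%E.

(* vL prolongs vK along the embedding iota, with index e.  Both valuations    *)
(* being normalized, e is the index of the value group of K in that of L; it  *)
(* is nonzero because 0 * +oo = 0 whereas vL 0 = +oo.                         *)
Definition ramification_index (K L : fieldType) (iota : K -> L)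
    (vK : K -> \bar int) (vL : L -> \bar int) (e : nat) : Prop :=
  forall x : K, vL (iota x) = ((e%:Z)%:E * vK x)%E.

(* x = a + {terms of strictly greater v-valuation}; this forces a != 0.       *)
Definition eq_up_to_higher (L : fieldType) (v : L -> \bar int) (x a : L)
  : Prop := (v a < v (x - a)%R)%E.

Section Tower.

Variables (K : fieldType) (F : splittingFieldType K).

(* w is the normalized valuation of the subfield E of F.  It is a function on *)
(* all of F, but only its values on E are constrained.                        *)
Definition subfield_valuation (vF : F -> \bar int) (E : {subfield F})
    (w : F -> \bar int) : Prop :=
  normalized_valuation (fun x : subvs_of E => w (vsval x)) /\
  exists e : nat,
    ramification_index (vsval : subvs_of E -> F)
      (fun x : subvs_of E => w (vsval x)) vF e.

Definition ram_group (vF : F -> \bar int) (pi : F) (j : nat) :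
    {set gal_of {:F}} :=
  [set s in 'Gal({:F} / 1)%g | ((j.+1%:Z)%:E <= vF (s pi - pi)%R)%E].

Definition jump (vF : F -> \bar int) (pi : F) (j : nat) : bool :=
  ram_group vF pi j.+1 \proper ram_group vF pi j.

(* The sequence b is indexed from 1 to h; past h the group is trivial.        *)
Definition jump_group (vF : F -> \bar int) (pi : F) (h : nat) (b : nat -> nat)
    (i : nat) : {set gal_of {:F}} :=
  if (i <= h)%N then ram_group vF pi (b i) else 1%g.

Definition jump_field (vF : F -> \bar int) (pi : F) (h : nat) (b : nat -> nat)
    (i : nat) : {subfield F} :=
  fixedField_aspace (jump_group vF pi h b i).

End Tower.

(* Main.v *)
Require Import Defs.
From mathcomp Require Import all_boot all_order all_algebra all_fingroup.
From mathcomp Require Import all_solvable all_field.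
From mathcomp Require Import constructive_ereal zify ring.

Set Implicit Arguments.
Unset Strict Implicit.

Import Order.TTheory GRing.Theory Num.Theory.
Local Open Scope ring_scope.

(** All valuations are compared through v_F.  If v_F maps E minus 0 into eZ and the
   integers k v_F(x), 0 < k < d, are not divisible by e, then the terms c_k x^k
   (c_k in E, k < d) have distinct valuations, so x has degree at least d over E.
   Applied to pi over E and to a uniformizer of E over K, this gives
   e(F/E) <= [F:E] and e(E/K) <= [E:K], hence equalities since F/K is totally
   ramified.  It also shows that F = K(pi), that v_F is Galois invariant (the
   minimal polynomial of pi is Eisenstein), and that every unit of F is congruent
   to an element of K.

   As b_i is prime to p, the minimal polynomial of f_i over F_i has degree
   p^(n_i), and its terms of positive degree have distinct valuations at f_i.
   They add up to D_i, whose valuation is that of an element of F_i, so the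
   dominant term is f_i^(p^(n_i)); hence v_i(D_i) = -b_i.  A mixed-radix expansion
   gives w_j and an element of F_1 whose product with the f_j^(w_j) has valuation
   -b_i, and a factor in K matches the leading coefficients.  If all w_j
   vanished, p would divide v_i(D_i) = -b_i. *)

(** * Elementary calculus of a normalized valuation *)

Section Valuation.

Variables (L : fieldType) (v : L -> \bar int).
Hypothesis hv : normalized_valuation v.

Lemma val0 : v 0 = +oo%E. Proof. by case: hv. Qed.

Lemma valM x y : v (x * y) = (v x + v y)%E.
Proof. by case: hv => _ _ + _ _; apply. Qed.

Lemma val_neq0 x : x != 0 -> exists t : int, v x = t%:E.
Proof. by case: hv => _ + _ _ _ => /[apply] /fineK <-; exists (fine (v x)). Qed.

Lemma val_fin_neq0 x (t : int) : v x = t%:E -> x != 0.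
Proof. by apply: contra_eq_neq => ->; rewrite val0. Qed.

Lemma valD_ge (c : \bar int) x y : (c <= v x -> c <= v y -> c <= v (x + y)%R)%E.
Proof. by case: hv => _ _ _ + _ => /(_ x y) + cx cy; apply: le_trans; rewrite le_min cx cy. Qed.

Lemma valD_gt (c : \bar int) x y : (c < v x -> c < v y -> c < v (x + y)%R)%E.
Proof. by case: hv => _ _ _ + _ => /(_ x y) + cx cy; apply: lt_le_trans; rewrite lt_min cx cy. Qed.

Lemma val1 : v 1 = 0%E.
Proof.
have [t vt] := val_neq0 (oner_neq0 L).
have := valM 1 1; rewrite mulr1 vt => -[tt].
by congr (_%:E); lia.
Qed.

Lemma valN x : v (- x) = v x.
Proof.
have [t vt] : exists t : int, v (-1) = t%:E by apply: val_neq0; rewrite oppr_eq0 oner_neq0.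
have := valM (-1) (-1); rewrite mulrNN mulr1 val1 vt => -[tt].
by rewrite -mulN1r valM vt (_ : t = 0) ?add0e //; lia.
Qed.

Lemma valB x y : v (x - y) = v (y - x).
Proof. by rewrite -valN opprB. Qed.

Lemma valX x (t : int) k : v x = t%:E -> v (x ^+ k) = (k%:Z * t)%:E.
Proof.
move=> vx; elim: k => [|k IH]; first by rewrite expr0 val1 mul0r.
by rewrite exprS valM vx IH -EFinD intS mulrDl mul1r.
Qed.

Lemma valX_ge0 x k : (0 <= v x -> 0 <= v (x ^+ k)%R)%E.
Proof. by move=> x0; elim: k => [|k IH]; rewrite ?expr0 ?val1 // exprS valM adde_ge0. Qed.

Lemma valV x (t : int) : v x = t%:E -> v x^-1 = (- t)%:E.
Proof.
move=> vx; have x0 := val_fin_neq0 vx.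
have [s vs] := val_neq0 (invr_neq0 x0).
have := valM x x^-1; rewrite divff // val1 vx vs => -[ts].
by congr (_%:E); lia.
Qed.

Lemma valXz x (t z : int) : v x = t%:E -> v (x ^ z) = (z * t)%:E.
Proof.
move=> vx; case: z => k; first exact: valX.
by rewrite (valV (valX k.+1 vx)) NegzE mulNr.
Qed.

Lemma val_prodX (r : seq nat) (x : nat -> L) (t : nat -> int) (w : nat -> nat) :
  {in r, forall j, v (x j) = (t j)%:E} ->
  v (\prod_(j <- r) x j ^+ w j) = (\sum_(j <- r) (w j)%:Z * t j)%:E.
Proof.
elim: r => [|j r IH] vx; first by rewrite !big_nil val1.
rewrite !big_cons valM (valX _ (vx j _)) ?mem_head // IH ?EFinD // => k kr.
by apply: vx; rewrite in_cons kr orbT.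
Qed.

Lemma val_sum_ge (c : \bar int) (I : Type) (r : seq I) (P : pred I) (g : I -> L) :
  (forall i, P i -> (c <= v (g i))%E) -> (c <= v (\sum_(i <- r | P i) g i)%R)%E.
Proof.
move=> cg; elim/big_ind: _ => //; first by rewrite val0 leey.
exact: valD_ge.
Qed.

Lemma val_sum_gt (t : int) (I : Type) (r : seq I) (P : pred I) (g : I -> L) :
  (forall i, P i -> (t%:E < v (g i))%E) -> (t%:E < v (\sum_(i <- r | P i) g i)%R)%E.
Proof.
move=> cg; elim/big_ind: _ => //; first by rewrite val0 ltry.
exact: valD_gt.
Qed.

Lemma eq_up_to_higher_val x a : eq_up_to_higher v x a -> v x = v a.
Proof.
rewrite /eq_up_to_higher => lt_xa; apply/eqP; rewrite eq_le.
apply/andP; split; last by rewrite -[x](subrK a) valD_ge // ltW.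
rewrite leNgt; apply/negP => lt_ax.
have := @valD_gt (v a) x (a - x) lt_ax; rewrite (valB a x) => /(_ lt_xa).
by rewrite addrC subrK ltxx.
Qed.

(** A term of least valuation dominates because no other term ties with it. Injectivity is asked of
    nonzero terms only, since vanishing terms all share the value [+oo]. *)
Lemma sum_dominant (I : finType) (g : I -> L) :
  (exists i, g i != 0) ->
  (forall i j, g i != 0 -> v (g i) = v (g j) -> i = j) ->
  exists i0, [/\ g i0 != 0, forall j, j != i0 -> (v (g i0) < v (g j))%E
    & eq_up_to_higher v (\sum_i g i) (g i0)].
Proof.
case=> i1 gi1 inj.
have [i0 _ min0] : exists2 i0, true & forall j, (v (g i0) <= v (g j))%E.
  have := Order.TotalTheory.arg_minP (P := predT) (fun i => v (g i)) (erefl : predT i1).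
  by case=> i0 _ min_i0; exists i0 => // j; apply: min_i0.
have gi0 : g i0 != 0.
  apply: contraTneq (min0 i1) => ->; rewrite val0 -ltNge.
  by have [t ->] := val_neq0 gi1; rewrite ltry.
have lt0 j : j != i0 -> (v (g i0) < v (g j))%E.
  move=> ji; rewrite lt_neqAle min0 andbT; apply: contra_neq ji => e.
  by rewrite -(inj i0 j).
exists i0; split => //; rewrite /eq_up_to_higher (bigD1 i0) //= addrAC subrr add0r.
by have [t vt] := val_neq0 gi0; rewrite vt; apply: val_sum_gt => i /lt0; rewrite vt.
Qed.

End Valuation.

Section TotalRamification.

Variables (K : fieldType) (F : splittingFieldType K) (vF : F -> \bar int).
Hypothesis hvF : normalized_valuation vF.

Definition val_multiples (E : {subfield F}) (e : nat) : Prop :=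
  forall c, c \in E -> c != 0 -> exists z : int, vF c = (e%:Z * z)%:E.

(** * Polynomial expressions in [x] over [E] whose terms have pairwise distinct valuations *)

Section Powers.

Variables (E : {subfield F}) (e : nat) (x : F) (t : int) (d : nat).
Hypotheses (hE : val_multiples E e) (vx : vF x = t%:E).
Hypothesis ht : forall k, (0 < k < d)%N -> ~~ (e %| absz (k%:Z * t)%R)%N.

(** Both coefficients have valuation in [e] times the integers, so a tie at [k < l] would make
    [(l - k) * t] divisible by [e], against [ht]. *)
Lemma coef_term_inj (q : {poly F}) (k l : nat) :
  q \is a polyOver E -> (k < d)%N -> (l < d)%N -> q`_k * x ^+ k != 0 ->
  vF (q`_k * x ^+ k) = vF (q`_l * x ^+ l) -> k = l.
Proof.
move=> /polyOverP qE; wlog lt_kl : k l / (k < l)%N => [hw kd ld qk0 ekl|].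
  case: (ltngtP k l) => [lt_kl|lt_lk|//]; first exact: hw.
  apply/esym/hw => //; apply: contraNneq qk0 => ql0.
  apply/negP => /negP /(val_neq0 hvF)[s].
  by rewrite ekl ql0 val0.
move=> _ ld /[dup] qk0 /(val_neq0 hvF)[s vs] ekl.
have ql0 : q`_l * x ^+ l != 0 by apply: (val_fin_neq0 hvF (t := s)); rewrite -ekl.
move: qk0 ql0; rewrite !mulf_eq0 !negb_or => /andP[qk0 _] /andP[ql0 _].
have [z vz] := hE (qE k) qk0; have [z' vz'] := hE (qE l) ql0.
move: ekl; rewrite !(valM hvF) !(valX hvF _ vx) vz vz' -!EFinD => -[ezz].
have /negP[] := ht (k := (l - k)%N) ltac:(lia).
have -> : (l - k)%N%:Z * t = e%:Z * (z - z') by rewrite -subzn 1?ltnW // mulrBl mulrBr; lia.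
by rewrite abszM dvdn_mulr.
Qed.

Lemma horner_dominant (q : {poly F}) :
  q \is a polyOver E -> q != 0 -> (size q <= d)%N ->
  exists k0, [/\ (k0 < d)%N, q`_k0 * x ^+ k0 != 0,
    forall k, (k < d)%N -> k != k0 -> (vF (q`_k0 * x ^+ k0) < vF (q`_k * x ^+ k))%E
    & eq_up_to_higher vF q.[x] (q`_k0 * x ^+ k0)].
Proof.
move=> qE q0 qd; have x0 := val_fin_neq0 hvF vx.
have [||k0 [gk0 lt_k0 dom]] := @sum_dominant _ _ hvF 'I_d (fun k : 'I_d => q`_k * x ^+ k).
- have ltq : ((size q).-1 < d)%N by rewrite (leq_trans _ qd) // prednK ?size_poly_gt0.
  by exists (Ordinal ltq); rewrite mulf_neq0 ?expf_neq0 // -lead_coefE lead_coef_eq0.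
- by move=> k l gk ekl; apply/val_inj/(coef_term_inj qE _ _ gk ekl).
exists k0; split=> //; last by rewrite (horner_coef_wide _ qd).
by move=> k kd nk; apply: (lt_k0 (Ordinal kd)).
Qed.

(** A nonzero polynomial of degree below [d] takes at [x] the finite valuation of its dominant term,
    so it cannot vanish there. *)
Lemma adjoin_degree_ge : (d <= adjoin_degree E x)%N.
Proof.
rewrite leqNgt; apply/negP => lt_d.
have [|||k0 [_ k0_neq0 _ dom]] := @horner_dominant (minPoly E x).
- exact: minPolyOver.
- exact: monic_neq0 (monic_minPoly E x).
- by rewrite size_minPoly.
have := eq_up_to_higher_val hvF dom; rewrite minPolyxx val0 //.
by have [s ->] := val_neq0 hvF k0_neq0.
Qed.

Hypothesis deg_x : adjoin_degree E x = d.

(* The terms of degrees 1, ..., d of the minimal polynomial have distinct valuations at x, and their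
   sum lies in E, so that its valuation can only be that of the term of degree d. *)
Lemma minPoly_dominant (m := minPoly E x) :
  vF (- m.[0]) = vF (x ^+ d) /\
  forall k, (0 < k < d)%N -> (vF (x ^+ d) < vF (m`_k * x ^+ k))%E.
Proof.
have x0 := val_fin_neq0 hvF vx.
have size_m : size m = d.+1 by rewrite size_minPoly deg_x.
have md : m`_d = 1.
  by have /monicP := monic_minPoly E x; rewrite lead_coefE size_minPoly deg_x.
have d_gt0 : (0 < d)%N by rewrite -deg_x.
have mE : m \is a polyOver E := minPolyOver E x.
(* Removing the constant term and dividing by [X] brings the degrees 1 to [d] down to 0 to [d - 1],
   the range covered by [horner_dominant]. *)
pose q := drop_poly 1 m.
have qE k : q`_k = m`_k.+1 by rewrite coef_drop_poly addn1.
have qOver : q \is a polyOver E.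
  by apply/polyOverP => k; rewrite qE; apply/polyOverP.
have size_q : size q = d by rewrite size_drop_poly size_m subn1.
have q0 : q != 0 by rewrite -size_poly_gt0 size_q.
have qx : q.[x] * x = - m.[0].
  have : m.[x] = 0 by apply: minPolyxx.
  rewrite -[m in m.[x]](poly_take_drop 1) hornerD hornerM hornerXn expr1 => /eqP.
  rewrite addrC addr_eq0 => /eqP ->; congr (- _).
  rewrite (_ : take_poly 1 m = (m.[0])%:P) ?hornerC //.
  by apply/polyP => k; rewrite coef_take_poly coefC horner_coef0; case: k.
have [|k0 [ltk0 k0_neq0 lt_k0 dom]] := horner_dominant qOver q0; first by rewrite size_q.
have vD : vF (- m.[0]) = vF (m`_k0.+1 * x ^+ k0.+1).
  by rewrite -qx (valM hvF) (eq_up_to_higher_val hvF dom) -(valM hvF) -mulrA -exprSr qE.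
have k0d : k0.+1 = d.
  (* Were the dominant degree [k0.+1] below [d], then [k0.+1 * t] would be a difference of two
     valuations of elements of [E], hence divisible by [e]. *)
  apply/eqP; rewrite eqn_leq ltk0 leqNgt /=; apply/negP => lt_k0d.
  have m0E : - m.[0] \in E by rewrite rpredN horner_coef0; apply/polyOverP.
  have mk_neq0 : m`_k0.+1 * x ^+ k0.+1 != 0 by rewrite exprSr mulrA -qE mulf_neq0.
  have [s vs] := val_neq0 hvF mk_neq0.
  have [z vz] := hE m0E (val_fin_neq0 hvF (etrans vD vs)).
  move: mk_neq0; rewrite mulf_eq0 negb_or => /andP[mk_neq0 _].
  have [z' vz'] := hE (polyOverP mE k0.+1) mk_neq0.
  move: vD; rewrite (valM hvF) (valX hvF _ vx) vz vz' -EFinD => -[ezz].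
  have /negP[] := ht (k := k0.+1) lt_k0d.
  have -> : k0.+1%:Z * t = e%:Z * (z - z') by rewrite mulrBr; lia.
  by rewrite abszM dvdn_mulr.
have vDd : vF (- m.[0]) = vF (x ^+ d) by rewrite vD k0d md mul1r.
split=> // k /andP[k_gt0 kd]; rewrite -vDd -qx -(prednK k_gt0) exprSr mulrA -qE.
have [s vs] := val_neq0 hvF k0_neq0.
rewrite !(valM hvF _ x) (eq_up_to_higher_val hvF dom) vx lteD2rE //; apply: lt_k0; lia.
Qed.

End Powers.

(** * Expansions in powers of the uniformizer, Galois invariance, and valuations of intermediate
    fields *)

Variables (vK : K -> \bar int) (pi : F).
Hypotheses (hvK : normalized_valuation vK) (hpi : vF pi = 1%:E).
Hypothesis hram : ramification_index (in_alg F) vK vF (\dim {:F}).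
Local Notation N := (\dim {:F}).

Lemma base_val_multiples : val_multiples 1%AS N.
Proof.
move=> c /vlineP[a ->]; rewrite scaler_eq0 oner_eq0 orbF => /(val_neq0 hvK)[z vz].
by exists z; rewrite [_%:A]/(in_alg F a) hram vz.
Qed.

Lemma not_dvdn_below d k : (0 < k < d)%N -> ~~ (d %| absz (k%:Z * 1)%R)%N.
Proof. by case/andP=> k0 kd; rewrite mulr1 absz_nat gtnNdvd. Qed.

Lemma dim_adjoin_le (E : {subfield F}) x : (adjoin_degree E x <= \dim_E {:F})%N.
Proof. by rewrite leq_divRL ?adim_gt0 // -dim_Fadjoin dimvS // subvf. Qed.

Lemma adjoin_degree_pi : adjoin_degree 1%AS pi = N.
Proof.
apply/eqP; rewrite eqn_leq (adjoin_degree_ge base_val_multiples hpi (@not_dvdn_below N)) andbT.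
by apply: leq_trans (dim_adjoin_le _ _) _; rewrite dimv1 divn1.
Qed.

Lemma pi_expansion x : exists q : {poly F},
  [/\ q \is a polyOver 1%AS, (size q <= N)%N & q.[pi] = x].
Proof.
exists (Fadjoin_poly 1%AS pi x); split; first exact: Fadjoin_polyOver.
  by rewrite -adjoin_degree_pi size_Fadjoin_poly.
apply: Fadjoin_poly_eq; suff -> : <<1%AS; pi>>%VS = fullv by rewrite memvf.
by apply/eqP; rewrite eqEdim subvf dim_Fadjoin adjoin_degree_pi dimv1 muln1 /=.
Qed.

(** Write [u] as a polynomial in [pi] of degree below [N] over the base field. The dominant term has
    valuation [N * z + k = 0] with [k < N], which forces [k = 0]: it is the constant coefficient. *)
Lemma residue_representative u : vF u = 0%E ->
  exists2 c, c \in 1%VS & eq_up_to_higher vF u c.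
Proof.
move=> vu; have [q [qE sq qx]] := pi_expansion u.
have q0 : q != 0.
  by apply: contraTneq (val_fin_neq0 hvF vu) => q0; rewrite -qx q0 horner0 eqxx.
have [k [kN k_neq0 _]] := horner_dominant base_val_multiples hpi (@not_dvdn_below N) qE q0 sq.
rewrite qx => dom; have := eq_up_to_higher_val hvF dom.
move: k_neq0; rewrite mulf_eq0 negb_or => /andP[qk _].
have qk1 : q`_k \in 1%AS by apply/polyOverP.
have [z vz] := base_val_multiples qk1 qk.
rewrite vu (valM hvF) vz (valX hvF _ hpi) -EFinD => -[zk].
have k0 : k = 0%N.
  case: (posnP k) => // k_gt0; have /negP[] := @not_dvdn_below N k ltac:(lia).
  have -> : k%:Z * 1 = N%:Z * - z by rewrite mulrN; lia.
  by rewrite abszM dvdn_mulr.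
by exists q`_k => //; move: dom; rewrite k0 expr0 mulr1.
Qed.

Lemma gal_fixes_base (s : gal_of {:F}) c : c \in 1%AS -> s c = c.
Proof. by case/vlineP=> a ->; rewrite linearZ /= rmorph1. Qed.

(** The conjugate [s pi] is a root of the same Eisenstein polynomial; comparing valuations in that
    equation leaves 1 as the only possible value. *)
Lemma val_gal_pi (s : gal_of {:F}) : vF (s pi) = 1%:E.
Proof.
have [v0 vk] := minPoly_dominant base_val_multiples hpi (@not_dvdn_below N) adjoin_degree_pi.
set m := minPoly _ _ in v0 vk.
have size_m : size m = N.+1 by rewrite size_minPoly adjoin_degree_pi.
have mN : m`_N = 1.
  by have /monicP := monic_minPoly 1%AS pi; rewrite lead_coefE size_minPoly adjoin_degree_pi.
have N_gt0 : (0 < N)%N by rewrite -adjoin_degree_pi.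
have m1 : m \is a polyOver 1%AS := minPolyOver 1%AS pi.
have sx : m.[s pi] = 0.
  have -> : m = map_poly s m.
    by apply/polyP => k; rewrite coef_map /= gal_fixes_base //; apply/polyOverP.
  by rewrite horner_map minPolyxx rmorph0.
have [t vt] : exists t : int, vF (s pi) = t%:E.
  by apply: (val_neq0 hvF); rewrite fmorph_eq0 (val_fin_neq0 hvF hpi).
have sumE : \sum_(1 <= k < N) m`_k * s pi ^+ k = - m.[0] - s pi ^+ N.
  have := sx; rewrite horner_coef size_m -(big_mkord xpredT (fun k => m`_k * s pi ^+ k)).
  rewrite big_nat_recr //= mN mul1r big_ltn // expr0 mulr1 -horner_coef0 => /eqP.
  by rewrite -addrA addrC addr_eq0 => /eqP <-; rewrite addrK.
move: v0; rewrite (valX hvF _ hpi) mulr1 => v0.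
(* The middle coefficients are divisible by a uniformizer of [K], that is, have [vF] at least [N];
   [z] ranges over extended integers to allow for a zero coefficient. *)
have vmk k : (0 < k < N)%N -> exists2 z : \bar int,
    (N%:Z%:E <= z)%E & vF (m`_k * s pi ^+ k) = (z + (k%:Z * t)%:E)%E.
  move=> kN; exists (vF m`_k); last by rewrite (valM hvF) (valX hvF _ vt).
  have mk1 : m`_k \in 1%AS by apply/polyOverP.
  have [->|mk0] := eqVneq m`_k 0; first by rewrite (val0 hvF) leey.
  have [z vz] := base_val_multiples mk1 mk0.
  have := vk k kN; rewrite (valM hvF) !(valX hvF _ hpi) vz -EFinD lte_fin lee_fin !mulr1 => ltN.
  by case: (lerP 1 z) => hz; nia.
have higher (r : int) : (forall k : nat, (0 < k < N)%N -> r < N%:Z + k%:Z * t) ->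
    (r%:E < vF (- m.[0] - s pi ^+ N))%E.
  move=> hr; rewrite -sumE big_nat_cond; apply: (val_sum_gt hvF) => k /andP[kN _].
  have [z Nz ->] := vmk k kN; apply: lt_le_trans (leeD2r _ Nz).
  by rewrite -EFinD lte_fin hr.
have vtN := valX hvF N vt.
(* If [t <= 0] the leading term balances the constant one and [N * t = N], which is absurd. If
   [t > 0] the same equality arises with the constant term dominating, and it gives [t = 1]. *)
have [t_le0|t_gt0] := leP t 0.
  have dom : eq_up_to_higher vF (- m.[0]) (s pi ^+ N).
    by rewrite /eq_up_to_higher vtN; apply: higher => k kN; nia.
  by have := eq_up_to_higher_val hvF dom; rewrite v0 vtN => -[]; nia.
have dom : eq_up_to_higher vF (s pi ^+ N) (- m.[0]).
  by rewrite /eq_up_to_higher v0 (valB hvF); apply: higher => k kN; nia.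
have := eq_up_to_higher_val hvF dom; rewrite v0 vtN => -[NtN].
by rewrite vt; congr (_%:E); nia.
Qed.

(** By [val_gal_pi], an automorphism preserves the valuation of every term of the expansion in [pi],
    so it cannot lower the valuation of the sum. Applying this to the inverse gives equality. *)
Lemma val_gal (s : gal_of {:F}) x : vF (s x) = vF x.
Proof.
suff le_gal (r : gal_of {:F}) y : (vF y <= vF (r y))%E.
  apply/eqP; rewrite eq_le le_gal andbT.
  have {2}-> : x = (s^-1)%g (s x) by rewrite -galM ?memvf // mulgV gal_id.
  exact: le_gal.
have [->|y0] := eqVneq y 0; first by rewrite rmorph0.
have [q [q1 sq qy]] := pi_expansion y.
have q0 : q != 0 by apply: contraNneq y0 => q0; rewrite -qy q0 horner0.
have [k0 [_ _ lt_k0]] := horner_dominant base_val_multiples hpi (@not_dvdn_below N) q1 q0 sq.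
rewrite qy => /(eq_up_to_higher_val hvF) vy.
have -> : r y = \sum_(k < N) q`_k * r pi ^+ k.
  rewrite -qy (horner_coef_wide _ sq) rmorph_sum; apply: eq_bigr => k _.
  by rewrite rmorphM rmorphXn /= gal_fixes_base //; apply/polyOverP.
apply: (val_sum_ge hvF) => k _.
have [tk vt] := val_neq0 hvF y0.
have -> : vF (q`_k * r pi ^+ k) = vF (q`_k * pi ^+ k).
  by rewrite !(valM hvF) (valX hvF _ (val_gal_pi r)) (valX hvF _ hpi).
rewrite vy; have [<-//|nk] := eqVneq (val k) k0.
exact/ltW/lt_k0.
Qed.

(** The ramification index is identified with the degree by a squeeze: [e <= [F:E]] and [N / e <=
    [E:K]], while the two degrees multiply to [N]. *)
Lemma val_subfield (E : {subfield F}) (w : F -> \bar int) : subfield_valuation vF E w ->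
  forall x, x \in E -> vF x = ((\dim_E {:F})%:Z%:E * w x)%E.
Proof.
case=> hw [e he].
have heE x : x \in E -> vF x = (e%:Z%:E * w x)%E by move=> xE; have := he (Subvs xE).
have e_gt0 : (0 < e)%N.
  rewrite lt0n; apply/eqP => e0; have := heE 0 (rpred0 _).
  by rewrite e0 mul0e (val0 hvF).
have hE : val_multiples E e.
  move=> c cE c0; have [|z vz] := @val_neq0 _ _ hw (Subvs cE); first by rewrite -(inj_eq val_inj).
  by exists z; rewrite (heE _ cE) vz.
have e_le : (e <= \dim_E {:F})%N.
  exact: leq_trans (adjoin_degree_ge hE hpi (@not_dvdn_below e)) (dim_adjoin_le E pi).
have [y [yE vy]] : exists y, y \in E /\ vF y = (e%:Z)%:E.
  case: hw => _ _ _ _ [y wy]; exists (vsval y); split; first exact: subvsP.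
  by rewrite heE ?subvsP // wy mule1.
(* A uniformizer of [K] has [vF] equal to [N] and lies in [E], so [e] divides [N]. *)
have [d Nde] : exists d, N = (d * e)%N.
  apply/dvdnP; case: (hvK) => _ _ _ _ [a va].
  have a1 : in_alg F a \in E by rewrite /= memvZ // mem1v.
  have a0 : in_alg F a != 0 by rewrite fmorph_eq0 (val_fin_neq0 hvK va).
  have [z] := hE _ a1 a0; rewrite hram va mule1 => -[Nz].
  by rewrite -[N]absz_nat Nz abszM absz_nat dvdn_mulr.
have d_le : (d <= \dim E)%N.
  have hd k : (0 < k < d)%N -> ~~ (N %| absz (k%:Z * e%:Z)%R)%N.
    by case/andP=> k0 kd; rewrite abszM !absz_nat Nde dvdn_pmul2r // gtnNdvd.
  apply: leq_trans (adjoin_degree_ge base_val_multiples vy hd) _.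
  have := dim_Fadjoin 1%AS y; rewrite dimv1 muln1 => <-.
  by apply/dimvS/FadjoinP; rewrite sub1v.
have dimE : N = (\dim_E {:F} * \dim E)%N by rewrite divnK // field_dimS // subvf.
have -> : \dim_E {:F} = e.
  by have := adim_gt0 E; nia.
exact: heE.
Qed.

Lemma subfield_val_multiples (E : {subfield F}) (w : F -> \bar int) :
  subfield_valuation vF E w -> val_multiples E (\dim_E {:F}).
Proof.
move=> hw c cE c0; have [|z wz] := @val_neq0 _ _ hw.1 (Subvs cE).
  by rewrite -(inj_eq val_inj).
by exists z; rewrite (val_subfield hw) // wz.
Qed.

Lemma subfield_val_lt (E : {subfield F}) (w : F -> \bar int) :
  subfield_valuation vF E w ->
  forall x y, x \in E -> y \in E -> (vF x < vF y)%E -> (w x < w y)%E.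
Proof.
move=> hw x y xE yE; rewrite !(val_subfield hw) // !ltNge; apply: contraNN => le_yx.
exact: lee_wpmul2l.
Qed.

(** * Ramification groups *)

(** Expand [x] in powers of [pi]: the coefficients are integral and fixed by [s], and each
    [s pi ^+ k - pi ^+ k] is a multiple of [s pi - pi]. This frees the definition from the choice of
    [pi], as normality requires. *)
Lemma ram_group_move (s : gal_of {:F}) j x : s \in ram_group vF pi j ->
  (0 <= vF x -> j.+1%:Z%:E <= vF (s x - x)%R)%E.
Proof.
rewrite inE => /andP[_ s_pi] x_ge0.
have [->|x0] := eqVneq x 0; first by rewrite rmorph0 subr0 (val0 hvF) leey.
have [q [q1 sq qx]] := pi_expansion x.
have q0 : q != 0 by apply: contraNneq x0 => q0; rewrite -qx q0 horner0.
have [k0 [_ _ lt_k0]] := horner_dominant base_val_multiples hpi (@not_dvdn_below N) q1 q0 sq.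
rewrite qx => /(eq_up_to_higher_val hvF) vx.
have q_ge0 k : (k < N)%N -> (0 <= vF q`_k)%E.
  move=> kN; have [->|qk] := eqVneq q`_k 0; first by rewrite (val0 hvF) leey.
  have qk1 : q`_k \in 1%AS by apply/polyOverP.
  have [z vz] := base_val_multiples qk1 qk.
  have : (0 <= vF (q`_k * pi ^+ k))%E.
    apply: le_trans x_ge0 _; rewrite vx; have [<-//|nk] := eqVneq k k0.
    exact/ltW/lt_k0.
  rewrite (valM hvF) (valX hvF _ hpi) vz -EFinD !lee_fin mulr1 => ge0.
  (* From [N * z + k >= 0] and [k < N] follows [z >= 0]. *)
  by case: (lerP 0 z) => hz; nia.
have pi_ge0 : (0 <= vF pi)%E by rewrite hpi.
have spi_ge0 : (0 <= vF (s pi))%E by rewrite val_gal.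
have -> : s x - x = \sum_(k < N) q`_k * (s pi ^+ k - pi ^+ k).
  rewrite -qx (horner_coef_wide _ sq) rmorph_sum -sumrB; apply: eq_bigr => k _.
  by rewrite rmorphM rmorphXn /= gal_fixes_base ?mulrBr //; apply/polyOverP.
apply: (val_sum_ge hvF) => k _; rewrite subrXX mulrCA (valM hvF).
rewrite -[leLHS]adde0; apply: leeD => //; rewrite (valM hvF) adde_ge0 ?q_ge0 //.
by apply: (val_sum_ge hvF) => l _; rewrite (valM hvF) adde_ge0 ?(valX_ge0 hvF).
Qed.

Lemma ram_group_group_set j : group_set (ram_group vF pi j).
Proof.
apply/group_setP; split; first by rewrite inE group1 gal_id subrr (val0 hvF) leey.
move=> s t; rewrite !inE => /andP[sG s_pi] /andP[tG t_pi]; rewrite groupM //=.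
rewrite galM ?memvf // -[t (s pi)](subrK (t pi)) -addrA (valD_ge hvF) //.
by rewrite -rmorphB val_gal.
Qed.

(** The conjugate of [s] by [t] moves [pi] by the image under [t] of the amount by which [s] moves
    [t^-1 pi]; [t] preserves [vF], and [ram_group_move] applies to [t^-1 pi]. *)
Lemma ram_group_norm i j : ram_group vF pi i \subset 'N(ram_group vF pi j)%g.
Proof.
apply/subsetP=> t; rewrite inE => /andP[tG _]; rewrite inE.
apply/subsetP=> _ /imsetP[s sj ->]; rewrite inE.
have sG : s \in 'Gal({:F} / 1)%g by move: sj; rewrite inE => /andP[].
rewrite groupJ //= /conjg !galM ?memvf //.
have {2}-> : pi = t ((t^-1)%g pi) by rewrite -galM ?memvf // mulVg gal_id.
by rewrite -rmorphB val_gal ram_group_move // val_gal hpi.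
Qed.

Lemma ram_groupS i j : (i <= j)%N -> ram_group vF pi j \subset ram_group vF pi i.
Proof.
move=> ij; apply/subsetP=> s; rewrite !inE => /andP[-> /=].
by apply: le_trans; rewrite lee_fin lez_nat.
Qed.

End TotalRamification.

(** * Arithmetic of the exponents *)

(** From a Bezout relation [u * q + u' * b = 1], take for [w] the residue of [- z * u'] modulo
    [q]. *)
Lemma solve_linear_congruence (q b : nat) (z : int) : (0 < q)%N -> coprime q b ->
  exists w z', (w < q)%N /\ z + w%:Z * b%:Z = q%:Z * z'.
Proof.
move=> q_gt0 cop; have /coprimezP[[u u'] /= uq] : coprimez q b by rewrite coprimezE.
pose w := ((- z * u') %% q%:Z)%Z.
have q0 : q%:Z != 0 by lia.
have w_ge0 : 0 <= w := modz_ge0 _ q0.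
have w_lt : w < q%:Z by rewrite ltz_pmod.
exists (absz w), (z * u - (- z * u' %/ q%:Z)%Z * b%:Z); split; first lia.
rewrite gez0_abs // (_ : w = - z * u' - (- z * u' %/ q%:Z)%Z * q%:Z).
  by rewrite -{1}[z]mulr1 -uq; ring.
by rewrite [X in X - _](divz_eq _ q%:Z) addrAC subrr add0r.
Qed.

(* Mixed-radix expansion: the digit w j is determined modulo q j, from the top index downwards. *)
Lemma mixed_radix_expansion (q b e : nat -> nat) (i : nat) (z : int) : (1 <= i)%N ->
  (forall j, (1 <= j < i)%N -> [/\ (0 < q j)%N, coprime (q j) (b j) & e j = (q j * e j.+1)%N]) ->
  exists (w : nat -> nat) (c : int), (forall j, (1 <= j < i)%N -> (w j < q j)%N) /\
    (e i)%:Z * z = (e 1%N)%:Z * c + \sum_(1 <= j < i) (w j)%:Z * (- (b j)%:Z * (e j.+1)%:Z).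
Proof.
move=> + hq; elim: i z hq => [//|[|i] IH] z hq _.
  by exists (fun=> 0%N), z; split=> [j|]; [lia | rewrite big_geq ?addr0].
have [|q_gt0 cop ei] := hq i.+1; first by rewrite leqnn.
(* The top digit [d] makes [z + d * b] divisible by [q]; the quotient [z'] is what the lower digits
   must represent. *)
have [d [z' [d_lt zd]]] := solve_linear_congruence z q_gt0 cop.
have [||w [c [w_lt wc]]] := IH z' => //.
  by move=> j /andP[j1 ji]; apply: hq; rewrite j1 ltnW.
exists (fun j => if j == i.+1 then d else w j), c; split=> [j|].
  by move=> /andP[j1 ji]; case: eqP => [->//|nj]; apply: w_lt; lia.
rewrite big_nat_recr //= eqxx addrA.
rewrite (eq_big_nat _ _ (F2 := fun j => (w j)%:Z * (- (b j)%:Z * (e j.+1)%:Z))) => [|j ji].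
  by rewrite -wc ei PoszM mulrAC -zd; ring.
by case: eqP => // ej; lia.
Qed.

Theorem mainTheorem2
  (K : fieldType) (F : splittingFieldType K) (p : nat)
  (vK : K -> \bar int) (vF : F -> \bar int) (pi : F)
  (h : nat) (b n : nat -> nat) (v : nat -> F -> \bar int) (f : nat -> F)
  (hvK : normalized_valuation vK)
  (hK : complete_valuation vK)
  (hp : residue_char vK p)
  (hgal : galois 1%AS {:F}%AS)
  (hvF : normalized_valuation vF)
  (hram : ramification_index (in_alg F) vK vF (\dim {:F}))
  (hpi : vF pi = 1%:E)
  (hG1 : ram_group vF pi 1 != 1%g)
  (hb_lt : forall i j, (1 <= i)%N -> (i < j)%N -> (j <= h)%N -> (b i < b j)%N)
  (hb_jump : forall j, (1 <= j)%N ->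
     jump vF pi j <-> exists2 i, (1 <= i <= h)%N & j = b i)
  (hb_ge1 : forall i, (1 <= i <= h)%N -> (1 <= b i)%N)
  (hn_ge1 : forall i, (1 <= i <= h)%N -> (1 <= n i)%N)
  (hn : forall i, (1 <= i <= h)%N ->
     ((jump_group vF pi h b i / jump_group vF pi h b i.+1)%g
        \isog [set: 'rV['F_p]_(n i)])%g)
  (hb_p : forall i, (1 <= i <= h)%N -> coprime p (b i))
  (hv : forall i, (1 <= i <= h.+1)%N ->
     subfield_valuation vF (jump_field vF pi h b i) (v i))
  (hfF : forall i, (1 <= i <= h)%N -> f i \in jump_field vF pi h b i.+1)
  (hfv : forall i, (1 <= i <= h)%N -> v i.+1 (f i) = (- (b i)%:Z)%R%:E)
  (i : nat) (hi : (2 <= i <= h)%N) :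
  let m := minPoly (jump_field vF pi h b i) (f i) in
  let D := - m.[0] in
  exists (kappa : F) (w : nat -> nat),
    let M := kappa * \prod_(1 <= j < i) f j ^+ w j in
    [/\ kappa \in jump_field vF pi h b 1 /\ kappa != 0,
        exists2 j, (1 <= j < i)%N & w j != 0%N,
        forall j, (1 <= j < i)%N -> (w j < p ^ n j)%N,
        eq_up_to_higher (v i) D M
      & [/\ m.[f i] + D = D,
            m.[f i] + D
              = f i ^+ (p ^ n i) + \sum_(1 <= k < p ^ n i) m`_k * f i ^+ k,
            forall k, (1 <= k < p ^ n i)%N ->
              (v i.+1 (f i ^+ (p ^ n i))%R < v i.+1 (m`_k * f i ^+ k)%R)%E,
            eq_up_to_higher (v i.+1) (m.[f i] + D) (f i ^+ (p ^ n i))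
          & eq_up_to_higher (v i.+1) D M]].
Proof.
have [p_pr _] := hp.
set G := jump_group vF pi h b; pose E := jump_field vF pi h b.
pose ramP := ram_group_group_set hvF hvK hpi hram.
have gG j : group_set (G j).
  by rewrite /G /jump_group; case: ifP => _; [exact: ramP | exact: group_set_one].
have nG j k : G j \subset 'N(G k)%g.
  rewrite /G /jump_group; case: (leqP k h) => _; last exact: norms1.
  by case: (leqP j h) => _; [exact: (ram_group_norm hvF hvK hpi hram) | rewrite sub1G].
have sG j k : (1 <= j <= k)%N -> G k \subset G j.
  move=> /andP[j1 jk]; rewrite /G /jump_group.
  case: (leqP k h) => [kh|_]; last first.
    by case: ifP => _; rewrite sub1set ?(group1 (Group (ramP _))) ?inE.
  rewrite (leq_trans jk kh); apply: ram_groupS.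
  by move: jk; rewrite leq_eqVlt => /orP[/eqP->//|jk]; rewrite ltnW ?hb_lt.
have sE j k : (1 <= j <= k)%N -> (E j <= E k)%VS.
  by move=> /sG sjk; apply: fixedFieldS.
(* By Galois theory this order is the degree of [F] over [E j], hence by total ramification also the
   ramification index. *)
pose e j := #|G j|.
have dimE j : \dim_(E j) {:F} = e j.
  by rewrite /e -[G j]/(gval (Group (gG j))) dim_fixedField.
have e_gt0 j : (0 < e j)%N by rewrite /e -[G j]/(gval (Group (gG j))) cardG_gt0.
have e_step j : (1 <= j <= h)%N -> e j = (p ^ n j * e j.+1)%N.
  move=> jh; have := hn j jh.
  rewrite -/G -[G j]/(gval (Group (gG j))) -[G j.+1]/(gval (Group (gG j.+1))) => /card_isog.
  rewrite card_quotient ?nG // cardsT card_mx card_Fp // mul1n => <-.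
  have sub : Group (gG j.+1) \subset Group (gG j) by apply: sG; lia.
  by rewrite mulnC; apply/esym/(Lagrange sub).
have vE j : (1 <= j <= h.+1)%N -> forall x, x \in E j -> vF x = ((e j)%:Z%:E * v j x)%E.
  by move=> /hv /(val_subfield hvF hvK hpi hram); rewrite dimE.
have multE j : (1 <= j <= h.+1)%N -> val_multiples vF (E j) (e j).
  by move=> /hv /(subfield_val_multiples hvF hvK hpi hram); rewrite dimE.
have vf j : (1 <= j <= h)%N -> vF (f j) = (- (b j)%:Z * (e j.+1)%:Z)%:E.
  by move=> jh; rewrite (vE j.+1 _ _ (hfF j jh)); [rewrite hfv // -EFinM mulrC | lia].
have [i_ge2 i_le] := andP hi; have i1h : (1 <= i <= h)%N by lia.
have i_gt0 : (0 < i)%N by lia.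
have ih1 : (1 <= i <= h.+1)%N by lia.
have i1h1 : (1 <= i.+1 <= h.+1)%N by lia.
have h_ge1 : (1 <= 1 <= h)%N by lia.
have lt_i_le_h j : (1 <= j < i)%N -> (1 <= j <= h)%N by lia.
move=> m D.
have cop : coprime (p ^ n i) (b i) by rewrite coprimeXl ?hb_p.
(* After cancelling [e i.+1] the claim is that [p ^ n i] does not divide [k * b i], which holds as
   [b i] is prime to [p] and [k] is too small. *)
have fi_small k : (0 < k < p ^ n i)%N ->
    ~~ (e i %| absz (k%:Z * (- (b i)%:Z * (e i.+1)%:Z))%R)%N.
  move=> /andP[k_gt0 k_lt]; rewrite !abszM abszN !absz_nat mulnA e_step //.
  by rewrite dvdn_pmul2r // Gauss_dvdl // gtnNdvd.
have deg_f : adjoin_degree (E i) (f i) = (p ^ n i)%N.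
  apply/eqP; rewrite eqn_leq (adjoin_degree_ge hvF (multE i ih1) (vf i i1h) fi_small) andbT.
  have dimEi : \dim (E i.+1) = (p ^ n i * \dim (E i))%N.
    have dimF j : \dim {:F} = (e j * \dim (E j))%N by rewrite -dimE divnK // field_dimS // subvf.
    apply/eqP; rewrite -(eqn_pmul2l (e_gt0 i.+1)) -dimF (dimF i) e_step //.
    by rewrite -mulnA mulnCA.
  rewrite -(leq_pmul2r (adim_gt0 (E i))) -dim_Fadjoin -dimEi dimvS //.
  by apply/FadjoinP; split; [apply: sE; rewrite i_gt0 leqnSn | exact: hfF].
have [vD vm] := minPoly_dominant hvF (multE i ih1) (vf i i1h) fi_small deg_f.
rewrite -/m -/D in vD vm.
have vfp := valX hvF (p ^ n i) (vf i i1h).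
have {}vD : vF D = ((e i)%:Z * - (b i)%:Z)%:E.
  by rewrite vD vfp (e_step i) // PoszM; congr (_%:E); ring.
have [||w [c [w_lt wc]]] :=
    @mixed_radix_expansion (fun j => p ^ n j)%N b e i (- (b i)%:Z) => //.
  move=> j ji; have jh := lt_i_le_h j ji.
  by split; [rewrite expn_gt0 prime_gt0 | rewrite coprimeXl ?hb_p | exact: e_step].
have [pi1 [pi1E vpi1]] : exists x, x \in E 1%N /\ vF x = (e 1%N)%:Z%:E.
  have h1 : (1 <= 1 <= h.+1)%N by [].
  case: (hv 1%N h1) => -[_ _ _ _ [x vx]] _; exists (vsval x); split; first exact: subvsP.
  by rewrite (vE 1%N h1) ?subvsP // vx mule1.
(* A first approximation with the valuation of [D] but possibly the wrong leading coefficient. The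
   exponent [c] may be negative, and [pi1] is a uniformizer of [E 1]. *)
pose M0 := pi1 ^ c * \prod_(1 <= j < i) f j ^+ w j.
have vM0 : vF M0 = vF D.
  rewrite vD wc /M0 (valM hvF) (valXz hvF _ vpi1).
  rewrite (val_prodX hvF (t := fun j => - (b j)%:Z * (e j.+1)%:Z)).
    by rewrite -EFinD mulrC.
  by move=> j; rewrite mem_index_iota => /lt_i_le_h; exact: vf.
have M0_neq0 : M0 != 0 by apply: (val_fin_neq0 hvF); rewrite vM0 vD.
have vu : vF (D / M0) = 0%E.
  have [s vs] := val_neq0 hvF M0_neq0.
  by rewrite (valM hvF) -vM0 (valV hvF vs) vs -EFinD subrr.
(* The unit [a] of the base field corrects the leading coefficient and is absorbed into [kappa]. *)
have [a a1 ua] := residue_representative hvF hvK hpi hram vu.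
have va : vF a = 0%E by rewrite -(eq_up_to_higher_val hvF ua).
exists (a * pi1 ^ c), w => M.
have M_E : M = a * M0 by rewrite /M /M0 mulrA.
have DM : eq_up_to_higher vF D M.
  rewrite /eq_up_to_higher M_E -[D](divfK M0_neq0) -mulrBl !(valM hvF _ M0).
  by rewrite vM0 vD lteD2rE.
have kappaE : a * pi1 ^ c \in E 1%N.
  rewrite rpredM // ?rpredXz //; apply: subvP a1; exact: sub1v.
have DE : D \in E i by rewrite rpredN horner_coef0; apply/polyOverP/minPolyOver.
have ME : M \in E i.
  have s1i : (E 1%N <= E i)%VS by apply: sE.
  apply: rpredM; first exact: (subvP s1i).
  rewrite big_seq; apply: rpred_prod => j; rewrite mem_index_iota => ji.
  have sji : (E j.+1 <= E i)%VS by apply: sE; case/andP: ji.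
  by apply/rpredX/(subvP sji)/hfF/lt_i_le_h.
(* Comparisons made with [vF] descend to [v j] only for elements of [E j], where [v j] is
   constrained; hence the membership facts around this step. *)
have up j x y : (1 <= j <= h.+1)%N -> x \in E j -> y \in E j ->
    eq_up_to_higher vF x y -> eq_up_to_higher (v j) x y.
  move=> jh xE yE; apply: (subfield_val_lt hvF hvK hpi hram (hv j jh)) => //.
  exact: rpredB.
have subE : (E i <= E i.+1)%VS by apply: sE; rewrite i_gt0 leqnSn.
have fE : f i \in E i.+1 by apply: hfF.
have mE k : m`_k \in E i.+1 by apply/(subvP subE)/polyOverP/minPolyOver.
have mx : m.[f i] = 0 := minPolyxx _ _.
have size_m : size m = (p ^ n i).+1 by rewrite size_minPoly deg_f.
have md : m`_(p ^ n i) = 1.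
  by have /monicP := monic_minPoly (E i) (f i); rewrite lead_coefE size_minPoly deg_f.
have sumE : m.[f i] + D = f i ^+ (p ^ n i) + \sum_(1 <= k < p ^ n i) m`_k * f i ^+ k.
  rewrite horner_coef size_m -(big_mkord xpredT (fun k => m`_k * f i ^+ k)).
  rewrite big_nat_recr //= md mul1r big_ltn ?expn_gt0 ?prime_gt0 // expr0 mulr1.
  by rewrite -horner_coef0 /D; ring.
split.
- by split=> //; rewrite mulf_neq0 ?(val_fin_neq0 hvF va) // expfz_neq0 // (val_fin_neq0 hvF vpi1).
- case: (boolP [exists j : 'I_i, (0 < j)%N && (w j != 0%N)]) => [/existsP[j /andP[j1 wj]]|].
    by exists (val j); rewrite ?j1 ?ltn_ord.
  (* With all digits zero, [wc] reads [e i * - b i = e 1 * c]. Since [i >= 2], the factor [p ^ n 1]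
     of [e 1] makes [p * e i] divide [e 1], so [p] would divide [b i]. *)
  move=> /existsPn w0; exfalso; move: wc.
  rewrite big_nat_cond big1 => [|j /andP[/andP[j1 ji] _]]; last first.
    by have := w0 (Ordinal ji); rewrite j1 /= negbK => /eqP ->; rewrite mul0r.
  have /dvdnP[r e1] : (p * e i %| e 1%N)%N.
    rewrite (e_step 1%N) // dvdn_mul ?dvdn_exp ?hn_ge1 //.
    have sub : Group (gG i) \subset Group (gG 2%N) by apply: sG; rewrite i_ge2.
    exact: (cardSg sub).
  rewrite addr0 e1 => eb; have := hb_p i i1h; rewrite prime_coprime // => /negP[].
  have e0 : (e i)%:Z != 0 by rewrite eqz_nat -lt0n.
  have bp : (b i)%:Z = p%:Z * - (r%:Z * c).
    by apply: (mulfI e0); move: eb; rewrite !PoszM; clear; lia.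
  by rewrite -[b i]absz_nat bp abszM dvdn_mulr.
- exact: w_lt.
- exact: up.
- split.
  + by rewrite mx add0r.
  + exact: sumE.
  + move=> k ki; apply: (subfield_val_lt hvF hvK hpi hram (hv _ i1h1)); rewrite ?rpredM ?rpredX //.
    exact: vm.
  + have fXE : f i ^+ (p ^ n i) \in E i.+1 by apply: rpredX.
    have mDE : m.[f i] + D \in E i.+1 by rewrite mx add0r (subvP subE).
    apply: (up i.+1 _ _ i1h1 mDE fXE).
    rewrite /eq_up_to_higher sumE addrAC subrr add0r vfp big_nat_cond.
    by apply: (val_sum_gt hvF) => k /andP[ki _]; rewrite -vfp vm.
  + by apply: up; rewrite ?(subvP subE).
Qed.
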